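(* Strong normalisation, weak normalisation and inductivity are not first-order definable. More precisely, none of $\mathrm{SN}$, $\mathrm{WN}$, $\mathrm{IND}$, $\neg\mathrm{SN}$, $\neg\mathrm{WN}$, $\neg\mathrm{IND}$ is a generalised first-order property of abstract rewrite systems.
   Context: An ARS is a pair $(A,\to)$, $A$ non-empty, ${\to}\subseteq A\times A$; $\twoheadrightarrow$ is the reflexive transitive closure. A normal form is an element with no outgoing step. SN: there is no infinite sequence $a_0\to a_1\to\cdots$. WN: every $a$ reduces ($\twoheadrightarrow$) to a normal form. IND (inductive): for every infinite sequence $a_0\to a_1\to a_2\to\cdots$ there is $a\in A$ with $a_i\twoheadrightarrow a$ for all $i$. $\neg P$ is the property of not having $P$. A property $P$ is a generalised first-order property if there is a set $\Phi$ of sentences of first-order logic with equality and a binary predicate symbol $\to$ (interpreted as the one-step relation) such that for every ARS $\mathcal{A}$, $\mathcal{A}$ has $P$ iff $\mathcal{A}\models\Phi$. *)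

(* Defs.v *)
From Stdlib Require Import Arith Relations.

Record ARS : Type := mkARS {
  carrier : Type;
  step : relation carrier;
  carrier_nonempty : inhabited carrier
}.

Definition reduces (A : ARS) : relation (carrier A) :=
  clos_refl_trans (carrier A) (step A).

Definition normal_form (A : ARS) (a : carrier A) : Prop :=
  ~ exists b : carrier A, step A a b.

Definition infinite_reduction (A : ARS) (s : nat -> carrier A) : Prop :=
  forall i : nat, step A (s i) (s (S i)).

Definition ARS_property : Type := ARS -> Prop.

Definition SN : ARS_property := fun A =>
  ~ exists s : nat -> carrier A, infinite_reduction A s.

Definition WN : ARS_property := fun A =>
  forall a : carrier A, exists b : carrier A, reduces A a b /\ normal_form A b.

Definition IND : ARS_property := fun A =>
  forall s : nat -> carrier A, infinite_reduction A s ->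
  exists a : carrier A, forall i : nat, reduces A (s i) a.

Definition negP (P : ARS_property) : ARS_property := fun A => ~ P A.

(* First-order formulas with equality over the signature consisting of one
   binary predicate symbol; variables are named by natural numbers. *)
Inductive formula : Type :=
| FEq : nat -> nat -> formula
| FStep : nat -> nat -> formula
| FNot : formula -> formula
| FAnd : formula -> formula -> formula
| FOr : formula -> formula -> formula
| FImp : formula -> formula -> formula
| FAll : nat -> formula -> formula
| FEx : nat -> formula -> formula.

Fixpoint free_in (x : nat) (phi : formula) : Prop :=
  match phi with
  | FEq y z | FStep y z => x = y \/ x = z
  | FNot p => free_in x p
  | FAnd p q | FOr p q | FImp p q => free_in x p \/ free_in x q
  | FAll y p | FEx y p => x <> y /\ free_in x p
  end.

Definition sentence (phi : formula) : Prop := forall x : nat, ~ free_in x phi.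

Definition update {T : Type} (v : nat -> T) (x : nat) (a : T) : nat -> T :=
  fun y => if Nat.eqb y x then a else v y.

Fixpoint sat (A : ARS) (v : nat -> carrier A) (phi : formula) : Prop :=
  match phi with
  | FEq x y => v x = v y
  | FStep x y => step A (v x) (v y)
  | FNot p => ~ sat A v p
  | FAnd p q => sat A v p /\ sat A v q
  | FOr p q => sat A v p \/ sat A v q
  | FImp p q => sat A v p -> sat A v q
  | FAll x p => forall a : carrier A, sat A (update v x a) p
  | FEx x p => exists a : carrier A, sat A (update v x a) p
  end.

(* On sentences the valuation is irrelevant, and one exists because the
   carrier is non-empty. *)
Definition models (A : ARS) (phi : formula) : Prop :=
  forall v : nat -> carrier A, sat A v phi.

Definition models_set (A : ARS) (Phi : formula -> Prop) : Prop :=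
  forall phi : formula, Phi phi -> models A phi.

Definition generalised_first_order (P : ARS_property) : Prop :=
  exists Phi : formula -> Prop,
    (forall phi : formula, Phi phi -> sentence phi) /\
    (forall A : ARS, P A <-> models_set A Phi).

(* Main.v *)
From Stdlib Require Import Arith ZArith List Lia Relations Classical.
Require Import Defs.
Import ListNotations.

(** The descending chain on the natural numbers is SN, hence also WN and IND.
    Adding a disjoint copy of the integers, again with steps [z -> z - 1],
    destroys all three properties.  The two systems are nevertheless
    elementarily equivalent: Duplicator wins every finite Ehrenfeucht-Fraisse
    game by keeping equal all signed distances of size at most [T] between
    pebbles (with a pebble on the origin from the start), where [T] is halved
    in each round.  Hence no set of sentences separates the two systems. *)

(** * Chains with signed distances *)

Open Scope Z_scope.

(* [shift z a b] says that [b] lies in the same component as [a], at signed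
   distance [z]; every component is a copy of the integers, except that of the
   origin, which is a copy of the natural numbers. *)
Record chain_system (A : ARS) : Type := {
  shift : Z -> relation (carrier A);
  origin : carrier A;
  shift_step : forall a b, step A a b <-> shift (-1) a b;
  shift_0 : forall a b, shift 0 a b <-> a = b;
  shift_trans : forall y z a b c, shift y a b -> shift z b c -> shift (y + z) a c;
  shift_sym : forall z a b, shift z a b -> shift (- z) b a;
  shift_inj : forall y z a b, shift y a b -> shift z a b -> y = z;
  origin_min : forall z a, shift z origin a -> 0 <= z;
  shift_total : forall z a,
    (exists b, shift z a b) \/ (exists n, 0 <= n < - z /\ shift (- n) a origin);
  far_element : forall T (l : list (carrier A)),
    exists a, forall b z, In b l -> Z.abs z <= T -> ~ shift z b a
}.

Arguments shift {A}.
Arguments origin {A}.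

Lemma shift_refl_iff {A : ARS} (CA : chain_system A) z a : shift CA z a a <-> z = 0.
Proof.
  assert (H0 : shift CA 0 a a) by now apply shift_0.
  split.
  - intros H. exact (shift_inj _ CA _ _ _ _ H H0).
  - now intros ->.
Qed.

Lemma shift_sym_iff {A : ARS} (CA : chain_system A) z a b :
  shift CA z a b <-> shift CA (- z) b a.
Proof.
  split; intros H; apply shift_sym in H; auto.
  now rewrite Z.opp_involutive in H.
Qed.

(** This replaces distances to a new pebble [c] by distances to an old pebble [b] near it. *)
Lemma shift_move {A : ARS} (CA : chain_system A) z a b c y :
  shift CA z b c -> (shift CA y a c <-> shift CA (y - z) a b).
Proof.
  intros Hz; split; intros H.
  - apply shift_sym in Hz. exact (shift_trans _ CA _ _ _ _ _ H Hz).
  - replace y with (y - z + z) by lia. exact (shift_trans _ CA _ _ _ _ _ H Hz).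
Qed.

(** * The Ehrenfeucht-Fraisse game *)

(** Duplicator's invariant, with [L] listing the pairs of pebbles. As distance 0 is equality and
    distance -1 is a step, for [T >= 1] it makes [L] a partial isomorphism. *)
Definition agree {A B : ARS} (CA : chain_system A) (CB : chain_system B)
    (T : Z) (L : list (carrier A * carrier B)) : Prop :=
  forall a b a' b' z, In (a, b) L -> In (a', b') L -> Z.abs z <= T ->
    (shift CA z a a' <-> shift CB z b b').

Definition swap_pairs {X Y : Type} (L : list (X * Y)) : list (Y * X) :=
  map (fun p => (snd p, fst p)) L.

Lemma in_swap_pairs {X Y : Type} (L : list (X * Y)) x y :
  In (y, x) (swap_pairs L) <-> In (x, y) L.
Proof.
  unfold swap_pairs; rewrite in_map_iff; split.
  - intros [[x' y'] [[= -> ->] H]]. exact H.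
  - intros H. now exists (x, y).
Qed.

Lemma agree_le {A B : ARS} (CA : chain_system A) (CB : chain_system B) T T' L :
  T' <= T -> agree CA CB T L -> agree CA CB T' L.
Proof.
  intros HT H a b a' b' z H1 H2 Hz. apply H; auto; lia.
Qed.

Lemma agree_swap {A B : ARS} (CA : chain_system A) (CB : chain_system B) T L :
  agree CA CB T L -> agree CB CA T (swap_pairs L).
Proof.
  intros H b a b' a' z H1 H2 Hz. rewrite in_swap_pairs in H1, H2.
  symmetry. exact (H _ _ _ _ _ H1 H2 Hz).
Qed.

Lemma agree_cons {A B : ARS} (CA : chain_system A) (CB : chain_system B) T L a b :
  agree CA CB T L ->
  (forall c d z, In (c, d) L -> Z.abs z <= T ->
     (shift CA z c a <-> shift CB z d b)) ->
  agree CA CB T ((a, b) :: L).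
Proof.
  intros H Hab c d c' d' z H1 H2 Hz.
  destruct H1 as [[= <- <-] | H1]; destruct H2 as [[= <- <-] | H2].
  - now rewrite !shift_refl_iff.
  - rewrite shift_sym_iff, (shift_sym_iff CB). apply Hab; auto; lia.
  - now apply Hab.
  - now apply H.
Qed.

(** If [a] is within [T] of an old pebble [c], Duplicator copies the displacement from the partner
    [d]. A distance of at most [T] to the new pebble then amounts to one of at most [2 * T] between
    old pebbles, which explains the halving. If [a] is far from all pebbles, any far element
    answers. *)
Lemma agree_forth {A B : ARS} (CA : chain_system A) (CB : chain_system B) T L :
  0 <= T -> In (origin CA, origin CB) L -> agree CA CB (2 * T) L ->
  forall a, exists b, agree CA CB T ((a, b) :: L).
Proof.
  intros HT HO HL a.
  assert (HL' : agree CA CB T L) by (apply agree_le with (2 * T); auto; lia).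
  destruct (classic (exists c d z, In (c, d) L /\ Z.abs z <= T /\ shift CA z c a))
    as [(c & d & z & Hcd & Hz & Hca) | Hfar].
  - destruct (shift_total _ CB z d) as [[b Hdb] | (n & Hn & Hdo)].
    + exists b. apply agree_cons; auto.
      intros c' d' y H' Hy.
      rewrite (shift_move CA z c' c a y Hca), (shift_move CB z d' d b y Hdb).
      apply HL; auto; lia.
    + exfalso.
      (* [c] is too close to the origin for [a] to exist. *)
      apply (HL c d (origin CA) (origin CB) (- n)) in Hdo; auto; try lia.
      apply shift_sym in Hdo.
      pose proof (origin_min _ CA _ _ (shift_trans _ CA _ _ _ _ _ Hdo Hca)). lia.
  - destruct (far_element _ CB T (map snd L)) as [b Hb].
    exists b. apply agree_cons; auto.
    intros c d z Hcd Hz; split; intros H; exfalso.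
    + apply Hfar. now exists c, d, z.
    + apply (Hb d z); auto. exact (in_map snd _ _ Hcd).
Qed.

Lemma agree_back {A B : ARS} (CA : chain_system A) (CB : chain_system B) T L :
  0 <= T -> In (origin CA, origin CB) L -> agree CA CB (2 * T) L ->
  forall b, exists a, agree CA CB T ((a, b) :: L).
Proof.
  intros HT HO HL b.
  destruct (agree_forth CB CA T (swap_pairs L) HT) with (a := b) as [a Ha].
  - now apply in_swap_pairs.
  - now apply agree_swap.
  - exists a. apply agree_swap in Ha.
    intros c d c' d' z H1 H2. apply Ha; rewrite in_swap_pairs.
    + destruct H1 as [[= <- <-] | H1]; [left | right; rewrite in_swap_pairs]; auto.
    + destruct H2 as [[= <- <-] | H2]; [left | right; rewrite in_swap_pairs]; auto.
Qed.

(** * From the game to elementary equivalence *)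

(** The agreement needed to preserve the truth of a formula: atoms inspect distances 0 and -1, and
    every quantifier costs one round, hence a factor 2. *)
Fixpoint radius (phi : formula) : Z :=
  match phi with
  | FEq _ _ => 0
  | FStep _ _ => 1
  | FNot p => radius p
  | FAnd p q | FOr p q | FImp p q => Z.max (radius p) (radius q)
  | FAll _ p | FEx _ p => 2 * radius p
  end.

Lemma radius_nonneg phi : 0 <= radius phi.
Proof. induction phi; cbn -[Z.mul Z.max]; lia. Qed.

(** Each quantifier is one round, whose pair is added to [L]. Pairs are never removed, even when a
    variable is rebound, so the origins stay in play. Constraining only free variables lets a
    sentence start from the origins alone. *)
Lemma sat_agree {A B : ARS} (CA : chain_system A) (CB : chain_system B) phi :
  forall L v w,
    In (origin CA, origin CB) L -> agree CA CB (radius phi) L ->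
    (forall x, free_in x phi -> In (v x, w x) L) ->
    (sat A v phi <-> sat B w phi).
Proof.
  assert (update_in : forall L x p (v : nat -> carrier A) (w : nat -> carrier B) a b,
    (forall y, y <> x /\ free_in y p -> In (v y, w y) L) ->
    forall y, free_in y p -> In (update v x a y, update w x b y) ((a, b) :: L)).
  { intros L x p v w a b H y Hy. unfold update.
    destruct (Nat.eqb_spec y x); [now left | right; auto]. }
  induction phi as [x y | x y | p IHp | p IHp q IHq | p IHp q IHq | p IHp q IHq
                   | x p IHp | x p IHp];
    cbn -[Z.mul Z.max]; intros L v w HO HL Hv.
  - rewrite <- (shift_0 _ CA), <- (shift_0 _ CB). apply HL; auto; lia.
  - rewrite (shift_step _ CA), (shift_step _ CB). apply HL; auto; lia.
  - now rewrite (IHp L v w).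
  - rewrite (IHp L v w), (IHq L v w); auto;
      try reflexivity; eapply agree_le; eauto; lia.
  - rewrite (IHp L v w), (IHq L v w); auto;
      try reflexivity; eapply agree_le; eauto; lia.
  - rewrite (IHp L v w), (IHq L v w); auto;
      try reflexivity; eapply agree_le; eauto; lia.
  - split.
    + intros H b.
      destruct (agree_back CA CB _ L (radius_nonneg p) HO HL b) as [a Hab].
      apply (IHp ((a, b) :: L) (update v x a)); auto; [now right | now apply update_in].
    + intros H a.
      destruct (agree_forth CA CB _ L (radius_nonneg p) HO HL a) as [b Hab].
      apply (IHp ((a, b) :: L) _ (update w x b)); auto; [now right | now apply update_in].
  - split.
    + intros [a H].
      destruct (agree_forth CA CB _ L (radius_nonneg p) HO HL a) as [b Hab].
      exists b. apply (IHp ((a, b) :: L) (update v x a)); auto; [now right | now apply update_in].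
    + intros [b H].
      destruct (agree_back CA CB _ L (radius_nonneg p) HO HL b) as [a Hab].
      exists a. apply (IHp ((a, b) :: L) _ (update w x b)); auto; [now right | now apply update_in].
Qed.

Lemma chain_systems_equivalent {A B : ARS} :
  chain_system A -> chain_system B ->
  forall phi, sentence phi -> models A phi -> models B phi.
Proof.
  intros CA CB phi Hphi HA w.
  apply (sat_agree CA CB phi [(origin CA, origin CB)] (fun _ => origin CA)).
  - now left.
  (* With the origins as the only pair, agreement holds up to every distance. *)
  - intros a b a' b' z [[= <- <-] | []] [[= <- <-] | []] _.
    now rewrite !shift_refl_iff.
  - intros x Hx. now destruct (Hphi x).
  - apply HA.
Qed.

Lemma not_generalised_first_order_of_chain_systems (P : ARS_property) (A B : ARS) :
  chain_system A -> chain_system B -> P A -> ~ P B ->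
  ~ generalised_first_order P.
Proof.
  intros CA CB HA HB (Phi & HPhi & HP). apply HB, HP. intros phi Hphi.
  apply (chain_systems_equivalent CA CB phi); auto.
  exact (proj1 (HP A) HA phi Hphi).
Qed.

(** * The two chains *)

Definition nat_chain : ARS :=
  mkARS nat (fun a b => a = S b) (inhabits 0%nat).

Definition nat_int_chain : ARS :=
  mkARS (nat + Z)
    (fun x y => match x, y with
                | inl a, inl b => a = S b
                | inr a, inr b => b = a - 1
                | _, _ => False
                end)
    (inhabits (inl 0%nat)).

Lemma bounded_on_list {X : Type} (f : X -> nat) (l : list X) :
  exists m, forall x, In x l -> (f x <= m)%nat.
Proof.
  exists (list_max (map f l)). intros x Hx.
  apply (proj1 (Forall_forall _ _) (proj1 (list_max_le _ _) (le_n _))).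
  now apply in_map.
Qed.

Lemma nat_chain_chain_system : chain_system nat_chain.
Proof.
  apply (Build_chain_system nat_chain
           (fun z (a b : nat) => Z.of_nat b = Z.of_nat a + z) 0%nat);
    simpl; intros; try lia.
  - destruct (Z_lt_le_dec (Z.of_nat a + z) 0).
    + right. exists (Z.of_nat a). lia.
    + left. exists (Z.to_nat (Z.of_nat a + z)). lia.
  - destruct (bounded_on_list (fun n : nat => n) l) as [m Hm].
    exists (S (m + Z.to_nat T)). intros b z Hb Hz. apply Hm in Hb. lia.
Qed.

Lemma nat_int_chain_chain_system : chain_system nat_int_chain.
Proof.
  apply (Build_chain_system nat_int_chain
           (fun z (x y : nat + Z) => match x, y with
                     | inl a, inl b => Z.of_nat b = Z.of_nat a + z
                     | inr a, inr b => b = a + z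
                     | _, _ => False
                     end) (inl 0%nat));
    simpl.
  - intros [a | a] [b | b]; lia.
  - intros [a | a] [b | b]; split; try easy.
    + intros H. f_equal. lia.
    + intros [= ->]. lia.
    + intros H. f_equal. lia.
    + intros [= ->]. lia.
  - intros y z [a | a] [b | b] [c | c]; lia.
  - intros z [a | a] [b | b]; lia.
  - intros y z [a | a] [b | b]; lia.
  - intros z [a | a]; lia.
  - intros z [a | a].
    + destruct (Z_lt_le_dec (Z.of_nat a + z) 0).
      * right. exists (Z.of_nat a). lia.
      * left. exists (inl (Z.to_nat (Z.of_nat a + z))). lia.
    + left. now exists (inr (a + z)).
  - intros T l.
    destruct (bounded_on_list
                (fun x : nat + Z => match x with inl n => n | inr _ => 0%nat end) l)
      as [m Hm].
    (* A far element is found among the naturals: integers in [l] are in the other component, and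
       naturals in [l] are at most [m]. *)
    exists (inl (S (m + Z.to_nat T))).
    intros [b | b] z Hb Hz; auto. apply Hm in Hb. lia.
Qed.

(** * Normalisation and inductivity of the two chains *)

(** Used directly for [nat_chain], and contrapositively to refute SN for [nat_int_chain]. *)
Lemma SN_IND (A : ARS) : SN A -> IND A.
Proof. intros H s Hs. destruct H. now exists s. Qed.

Lemma SN_nat_chain : SN nat_chain.
Proof.
  intros [s Hs].
  assert (H : forall i, (s i + i = s 0)%nat).
  { induction i as [| i IH]; [lia |]. specialize (Hs i). simpl in *. lia. }
  specialize (H (S (s 0%nat))). simpl in *. lia.
Qed.

Lemma WN_nat_chain : WN nat_chain.
Proof.
  intros a. exists 0%nat. split.
  - induction a as [| a IH]; [apply rt_refl |].
    apply rt_trans with a; [now apply rt_step | exact IH].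
  - intros [b Hb]. discriminate Hb.
Qed.

(** Hence a normal form of an integer would be an integer, which always has a step, and a common
    reduct of integers would be a lower bound for them. *)
Lemma reduces_int (x y : carrier nat_int_chain) (z : Z) :
  reduces nat_int_chain x y -> x = inr z -> exists z', y = inr z' /\ z' <= z.
Proof.
  intros H. revert z. induction H as [x y H | x | x y w _ IH1 _ IH2]; intros z Hx.
  - subst x. destruct y as [b | b]; simpl in H; [easy |]. exists b. split; [easy | lia].
  - exists z. split; [easy | lia].
  - destruct (IH1 z Hx) as (z1 & Hy & H1). destruct (IH2 z1 Hy) as (z2 & Hw & H2).
    exists z2. split; [easy | lia].
Qed.

Lemma not_WN_nat_int_chain : ~ WN nat_int_chain.
Proof.
  intros H. destruct (H (inr 0)) as (b & Hb & Hnf).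
  destruct (reduces_int _ _ 0 Hb eq_refl) as (z & -> & _).
  apply Hnf. now exists (inr (z - 1)).
Qed.

Lemma not_IND_nat_int_chain : ~ IND nat_int_chain.
Proof.
  intros H. destruct (H (fun i => inr (- Z.of_nat i))) as [a Ha].
  - intros i. simpl step. lia.
  - destruct (reduces_int _ _ _ (Ha 0%nat) eq_refl) as (z & -> & _).
    (* At this index the sequence is already strictly below the supposed bound [z]. *)
    destruct (reduces_int _ _ _ (Ha (S (Z.to_nat (- z)))) eq_refl) as (z' & [= <-] & Hz).
    lia.
Qed.

Theorem theorem3p17 :
  ~ generalised_first_order SN /\
  ~ generalised_first_order WN /\
  ~ generalised_first_order IND /\
  ~ generalised_first_order (negP SN) /\
  ~ generalised_first_order (negP WN) /\
  ~ generalised_first_order (negP IND).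
Proof.
  pose proof nat_chain_chain_system as CN.
  pose proof nat_int_chain_chain_system as CZ.
  assert (separated : forall P : ARS_property, P nat_chain -> ~ P nat_int_chain ->
            ~ generalised_first_order P /\ ~ generalised_first_order (negP P)).
  { intros P HN HZ. split.
    - exact (not_generalised_first_order_of_chain_systems P _ _ CN CZ HN HZ).
    (* For the negation the two systems exchange roles. *)
    - apply (not_generalised_first_order_of_chain_systems _ _ _ CZ CN HZ).
      intros H. exact (H HN). }
  destruct (separated SN SN_nat_chain) as [HSN HnSN].
  { intros H. exact (not_IND_nat_int_chain (SN_IND _ H)). }
  destruct (separated WN WN_nat_chain not_WN_nat_int_chain) as [HWN HnWN].
  destruct (separated IND (SN_IND _ SN_nat_chain) not_IND_nat_int_chain) as [HIND HnIND].
  repeat split; assumption.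
Qed.
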